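(* Let $r$ be a positive integer or $r=\infty$. For every $n\in\mathbb{Z}$, $$\Gamma_r(z)h_n=\frac{1}{E_r(z)}\left(h_n-\frac{h_{n-1}}{z}\right),\qquad\text{i.e.}\qquad G_r(z)h_n=h_n-\frac{h_{n-1}}{z}.$$
   Context: Let $r\in\{1,2,3,\dots\}\cup\{\infty\}$. $B_r=\mathbb{Q}[e_i : i\in\mathbb{N},\ 1\le i\le r]$ is a polynomial ring; $e_0=1$ and $e_i=0$ for $i>r$. $E_r(t)=1+\sum_{1\le i\le r}(-1)^ie_it^i\in B_r[[t]]$, and $H_r=(h_n)_{n\in\mathbb{Z}}$ is defined by $\sum_{n\in\mathbb{Z}}h_nt^n=1/E_r(t)$ (so $h_n=0$ for $n<0$, $h_0=1$). $\mathcal{P}_r$ is the set of partitions $\boldsymbol{\lambda}=(\lambda_1\ge\lambda_2\ge\cdots)$ with at most $r$ nonzero parts (all partitions if $r=\infty$). $\Delta_{\boldsymbol{\lambda}}(H_r)=\det(h_{\lambda_j-j+i})_{1\le i,j\le k}$, where $k=r$ if $r<\infty$ and $k$ is any integer at least the length of $\boldsymbol{\lambda}$ if $r=\infty$ (the value does not depend on $k$). It is known that $(\Delta_{\boldsymbol{\lambda}}(H_r))_{\boldsymbol{\lambda}\in\mathcal{P}_r}$ is a $\mathbb{Q}$-basis of $B_r$; for $n\ge0$, $h_n=\Delta_{(n)}(H_r)$. For $j\in\mathbb{Z}$ let $u_j=\sum_{n\ge0}h_{n+j}\frac{t^n}{n!}\in B_r[[t]]$ (linearly independent over $\mathbb{Q}$).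 Semi-infinite exterior monomials $u_{i_0}\wedge u_{i_1}\wedge\cdots$ (with $i_{m+1}=i_m-1$ for all large $m$) are formal symbols over $\mathbb{Q}$, alternating in their entries. Put $\Phi^r_{i,\boldsymbol{\lambda}}=u_{i+\lambda_1}\wedge u_{i-1+\lambda_2}\wedge u_{i-2+\lambda_3}\wedge\cdots$ (with $\lambda_m=0$ beyond the length of $\boldsymbol{\lambda}$), $\Phi^r_0=\Phi^r_{0,(0)}$. For $\phi=\sum_{n\ge0}a_n\frac{t^n}{n!}\in B_r[[t]]$ and $k\in\mathbb{N}$ let $U_k(\phi)=a_k+\sum_{i\ge1}(-1)^ie_ia_{k-i}$, where $a_j=0$ for $j<0$; then $\phi=\sum_{i\ge0}U_i(\phi)u_{-i}$. For a monomial $\alpha=u_{i_0}\wedge u_{i_1}\wedge\cdots$ with $i_m=-m$ for all $m\ge k$, put $[\alpha]=(\alpha\otimes_{\mathbb{Q}}1_{B_r})/\Phi^r_0=\det\big(U_a(u_{i_b})\big)_{0\le a,b\le k-1}\in B_r$ (independent of $k$; this is the result of expanding each $u_{i_b}$ $B_r$-linearly in the $u_{-a}$, $a\ge0$). Extend $[\cdot]$ $\mathbb{Q}$-linearly. The vertex operator $\Gamma_r(z)$ is the $\mathbb{Q}$-linear map on $B_r$ with $\Gamma_r(z)\Delta_{\boldsymbol{\lambda}}(H_r)=\sum_{i\in\mathbb{Z}}[u_i\wedge\Phi^r_{-1,\boldsymbol{\lambda}}]\,z^i$ for $\boldsymbol{\lambda}\in\mathcal{P}_r$. Only finitely many negative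 powers of $z$ occur, so the values lie in $B_r((z))$. $G_r(z)$ is the $\mathbb{Q}$-linear map with $G_r(z)\Delta_{\boldsymbol{\lambda}}(H_r)=E_r(z)\cdot\big(\Gamma_r(z)\Delta_{\boldsymbol{\lambda}}(H_r)\big)$. *)

(* Defs.v *)
From HB Require Import structures.
From mathcomp Require Import all_boot all_order all_algebra.
From mathcomp Require Import finmap monalg.
From mathcomp Require Import boolp classical_sets functions cardinality fsbigop.

Set Implicit Arguments.
Unset Strict Implicit.
Unset Printing Implicit Defensive.

Import Order.TTheory GRing.Theory Num.Theory.
Local Open Scope ring_scope.

(* A power series over [R] is its sequence of coefficients [nat -> R].  The
   pointwise product that the library puts on [nat -> R] is never used: products
   and inverses of series are [fps_mul] and [fps_inv]. *)

Section PowerSeries.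
Variable R : comNzRingType.
Implicit Types p q : nat -> R.

Definition fps_mul p q : nat -> R :=
  fun n => \sum_(i < n.+1) p i * q (n - i)%N.

(* [fps_inv_prefix p n] lists the coefficients of index at most [n] of 1/p,
   for p with constant term 1. *)
Fixpoint fps_inv_prefix p (n : nat) : seq R :=
  if n is m.+1 then
    let s := fps_inv_prefix p m in
    rcons s (- \sum_(i < m.+1) p i.+1 * s`_(m - i))
  else [:: 1].

Definition fps_inv p : nat -> R := fun n => (fps_inv_prefix p n)`_n.

Lemma size_fps_inv_prefix p n : size (fps_inv_prefix p n) = n.+1.
Proof. by elim: n => //= n IHn; rewrite size_rcons IHn. Qed.

Lemma nth_fps_inv_prefix p n k :
  (k <= n)%N -> (fps_inv_prefix p n)`_k = fps_inv p k.
Proof.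
elim: n => [|n IHn]; first by rewrite leqn0 => /eqP ->.
rewrite leq_eqVlt => /orP[/eqP -> //|lt_kn].
by rewrite /= nth_rcons size_fps_inv_prefix lt_kn IHn.
Qed.

Lemma fps_mulV p : p 0%N = 1 ->
  forall n, fps_mul p (fps_inv p) n = (n == 0%N)%:R.
Proof.
move=> p0 [|n]; first by rewrite /fps_mul big_ord1 p0 mul1r.
rewrite /fps_mul big_ord_recl p0 mul1r subn0 [X in X + _]/fps_inv /=.
rewrite nth_rcons size_fps_inv_prefix ltnn eqxx addrC.
apply/eqP; rewrite subr_eq0; apply/eqP/eq_bigr => i _.
by rewrite nth_fps_inv_prefix ?leq_subr // lift0 subSS.
Qed.

End PowerSeries.

(* [None] stands for infinity. *)
Definition rank := option nat.

Definition le_rank (i : nat) (r : rank) : bool :=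
  if r is Some k then (i <= k)%N else true.

Definition rank_pos (r : rank) : bool := le_rank 1 r.

Definition evar (r : rank) : Type :=
  {i : nat | (0 < i)%N && le_rank i r}.
HB.instance Definition _ r := Choice.on (evar r).

(* The polynomial ring is the monoid algebra of the free commutative monoid on
   the variables, which covers finitely and infinitely many variables alike. *)
Definition B (r : rank) : Type := {malg rat[{cmonom (evar r)}]}.
HB.instance Definition _ r := GRing.ComAlgebra.on (B r).

(* e_0 = 1 and e_i = 0 for i > r. *)
Definition e (r : rank) (i : nat) : B r :=
  if i is 0%N then 1
  else if insub i is Some v then << ucm (v : evar r) >> else 0.

Definition E (r : rank) : nat -> B r := fun i => (-1) ^+ i * e r i.

Definition h (r : rank) (n : int) : B r :=
  if n is Posz m then fps_inv (E r) m else 0.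

Lemma E0 r : E r 0%N = 1.
Proof. by rewrite /E mul1r. Qed.

Definition is_partition (l : seq nat) : bool := sorted geq l && (0%N \notin l).

Definition in_P (r : rank) (l : seq nat) : bool :=
  is_partition l && le_rank (size l) r.

(* [part l m] is the part of index m + 1. *)
Definition part (l : seq nat) (m : nat) : nat := nth 0%N l m.

Definition Delta (r : rank) (l : seq nat) : B r :=
  let k := if r is Some k then k else size l in
  \det (\matrix_(i < k, j < k)
          h r ((part l j)%:Z - (j : nat)%:Z + (i : nat)%:Z)).

Definition u (r : rank) (j : int) : nat -> B r :=
  fun n => (n`!%:R : rat)^-1 *: h r (n%:Z + j).

(* For phi = sum_n a_n t^n / n!, the numbers a_n are n! times the coefficients. *)
Definition U (r : rank) (k : nat) (phi : nat -> B r) : B r :=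
  \sum_(i < k.+1) (-1) ^+ i * e r i * ((k - i)`!%:R * phi (k - i)%N).

(* The symbol u_{i_0} /\ u_{i_1} /\ ... is given by its sequence of indices;
   [wedge c] holds those with i_m = c - m for all large m.  The alternating rule
   is not imposed on the symbols: it only matters through [bracket], a
   determinant with one column for each factor.  The value of [bracket] does not
   depend on the bound [wtail]. *)
Record wedge (c : int) := Wedge {
  windex :> nat -> int;
  wtail : nat;
  wtailP : forall m, (wtail <= m)%N -> windex m = c - m%:Z
}.

Fact Phi_subproof (c : int) (l : seq nat) m :
  (size l <= m)%N -> c - m%:Z + (part l m)%:Z = c - m%:Z.
Proof. by move=> le_lm; rewrite /part nth_default // addr0. Qed.

Definition Phi (c : int) (l : seq nat) : wedge c :=
  @Wedge c (fun m => c - m%:Z + (part l m)%:Z) (size l) (@Phi_subproof c l).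

Fact wcons_subproof (i c : int) (w : wedge c) m : ((wtail w).+1 <= m)%N ->
  (if m is m'.+1 then w m' else i) = c + 1 - m%:Z.
Proof.
by case: m => // m le_wm; rewrite wtailP // intS opprD addrA addrK.
Qed.

Definition wcons (i : int) (c : int) (w : wedge c) : wedge (c + 1) :=
  @Wedge (c + 1) (fun m => if m is m'.+1 then w m' else i) (wtail w).+1
    (@wcons_subproof i c w).

Definition bracket (r : rank) (w : wedge 0) : B r :=
  \det (\matrix_(a < wtail w, b < wtail w) U a (u r (w b))).

Definition laurent_pred (r : rank) : {pred (int -> B r)} :=
  fun f => `[< exists N : int, forall n : int, n < N -> f n = 0 >].

Lemma laurent_submod_closed r : submod_closed (@laurent_pred r).
Proof.
split; first by apply/asboolP; exists 0.
move=> a f g /asboolP[N fN] /asboolP[M gM]; apply/asboolP.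
exists (Num.min N M) => n; rewrite lt_min => /andP[nN nM].
have -> : (a *: f + g) n = a *: f n + g n by [].
by rewrite fN // gM // scaler0 addr0.
Qed.
HB.instance Definition _ r :=
  GRing.isSubmodClosed.Build rat (int -> B r) (@laurent_pred r)
    (@laurent_submod_closed r).

Record laurent (r : rank) : Type := Laurent {
  lcoef :> int -> B r;
  lcoefP : lcoef \in @laurent_pred r
}.
HB.instance Definition _ r := [isSub for @lcoef r].
HB.instance Definition _ r := [Choice of laurent r by <:].
HB.instance Definition _ r := [SubChoice_isSubLmodule of laurent r by <:].

Definition lmul_coef (r : rank) (f g : laurent r) : int -> B r :=
  fun n => \sum_(k \in [set: int]) (f k * g (n - k)).

(* So the finitely supported sum in [lmul_coef] never takes its default value. *)
Lemma lmul_finite r (f g : laurent r) (n : int) :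
  finite_set [set k : int | f k * g (n - k) != 0].
Proof.
have /asboolP[N fN] := lcoefP f; have /asboolP[M gM] := lcoefP g.
have fin : finite_set [set N + m%:Z | m in `I_(absz (n - M - N)%R).+1].
  exact: finite_image (finite_II _).
apply: sub_finite_set fin => k /= fg0.
have leNk : N <= k.
  by rewrite leNgt; apply/negP => /fN fk0; rewrite fk0 mul0r eqxx in fg0.
have leMk : k <= n - M.
  rewrite lerBrDl -lerBrDr leNgt; apply/negP => /gM gk0.
  by rewrite gk0 mulr0 eqxx in fg0.
exists (absz (k - N)%R); last by rewrite gez0_abs ?subr_ge0 // addrC subrK.
rewrite /= ltnS -lez_nat !gez0_abs ?subr_ge0 ?lerD2r //.
exact: le_trans leMk.
Qed.

Fact lmul_subproof r (f g : laurent r) : lmul_coef f g \in @laurent_pred r.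
Proof.
have /asboolP[N fN] := lcoefP f; have /asboolP[M gM] := lcoefP g.
apply/asboolP; exists (N + M) => n ltn.
rewrite /lmul_coef fsbig1 // => k _.
have [/fN ->|leNk] := ltP k N; first by rewrite mul0r.
rewrite gM ?mulr0 // ltrBlDr addrC; apply: (lt_le_trans ltn).
by rewrite lerD2r.
Qed.

Definition lmul (r : rank) (f g : laurent r) : laurent r :=
  Laurent (lmul_subproof f g).

Fact lfps_subproof r (p : nat -> B r) :
  (fun n : int => if n is Posz m then p m else 0) \in @laurent_pred r.
Proof. by apply/asboolP; exists 0; case. Qed.

Definition lfps (r : rank) (p : nat -> B r) : laurent r :=
  Laurent (lfps_subproof p).

Fact lmonom_subproof r (c : B r) (k : int) :
  (fun n : int => if n == k then c else 0) \in @laurent_pred r.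
Proof. by apply/asboolP; exists k => n /lt_eqF ->. Qed.

(* c z^k *)
Definition lmonom (r : rank) (c : B r) (k : int) : laurent r :=
  Laurent (lmonom_subproof c k).

(* The [Delta r l], for [l] in P_r, form a Q-basis of [B r], so there is exactly
   one linear map with each of the two properties below.  The index [i] runs over
   all of Z. *)
Definition is_Gamma (r : rank) (Gamma : {linear B r -> laurent r}) : Prop :=
  forall l : seq nat, in_P r l ->
  forall i : int, Gamma (Delta r l) i = bracket r (wcons i (Phi (-1) l)).

Definition is_G (r : rank) (Gamma G : {linear B r -> laurent r}) : Prop :=
  forall l : seq nat, in_P r l ->
  G (Delta r l) = lmul (lfps (E r)) (Gamma (Delta r l)).

(* Main.v *)
(* For n > 0 the bracket [u_i /\ u_(n-1) /\ u_(-2) /\ ...] is the 2x2 determinant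
   | h_i                h_(n-1)           |
   | h_(i+1) - e_1 h_i  h_n - e_1 h_(n-1) |  =  h_i h_n - h_(i+1) h_(n-1),
   and this value is also right for n <= 0.  It is the coefficient of z^i in
   (sum_j h_j z^j) (h_n - h_(n-1) / z), where the first factor is 1 / E_r(z). *)

Require Import Defs.
From mathcomp Require Import all_boot all_order all_algebra.
From mathcomp Require Import boolp classical_sets fsbigop zify ring.

Import GRing.Theory Num.Theory.
Local Open Scope ring_scope.

Lemma h_nat (r : rank) (m : nat) : h r m = fps_inv (E r) m.
Proof. by []. Qed.

Lemma h_neg (r : rank) (i : int) : i < 0 -> h r i = 0.
Proof. by case: i. Qed.

Lemma h0 (r : rank) : h r 0 = 1.
Proof. by []. Qed.

Lemma lfps_inv_E (r : rank) (i : int) : lfps (fps_inv (E r)) i = h r i.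
Proof. by case: i. Qed.

Lemma laurentP (r : rank) (f g : laurent r) : (forall i, f i = g i) -> f = g.
Proof. by move=> fg; apply/val_inj/funext. Qed.

Lemma laurentB (r : rank) (f g : laurent r) (i : int) : (f - g) i = f i - g i.
Proof. by []. Qed.

Lemma lmonomE (r : rank) (c : B r) (k i : int) :
  lmonom c k i = if i == k then c else 0.
Proof. by []. Qed.

Lemma lmul_seq (r : rank) (f g : laurent r) (i : int) (s : seq int) : uniq s ->
    (forall k, k \notin s -> f k * g (i - k) = 0) ->
  lmul f g i = \sum_(k <- s) f k * g (i - k).
Proof.
move=> s_uniq fg0; rewrite [LHS](@fsbigE _ _ _ _ _ s) //.
  by apply: eq_bigl => k; exact: in_setT.
by move=> k _; exact: fg0.
Qed.

Lemma lmul_lfps (r : rank) (p : nat -> B r) (g : laurent r) (i : int) (M : nat) :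
    (forall k : nat, (M <= k)%N -> g (i - k%:Z) = 0) ->
  lmul (lfps p) g i = \sum_(k < M) p k * g (i - k%:Z).
Proof.
move=> g0; rewrite (@lmul_seq _ _ _ _ [seq Posz k | k <- index_iota 0 M]).
- by rewrite big_map big_mkord.
- by rewrite map_inj_uniq ?iota_uniq // => x y [].
move=> [k|k] /=; last by rewrite mul0r.
rewrite mem_map; last by move=> x y [].
by rewrite mem_index_iota /= -leqNgt => /g0 ->; rewrite mulr0.
Qed.

Lemma lmul_lmonomB (r : rank) (f : laurent r) (c d : B r) (i : int) :
  lmul f (lmonom c 0 - lmonom d (-1)) i = f i * c - f (i + 1) * d.
Proof.
(* The right factor lives in degrees 0 and -1, so only [k = i] and [k = i + 1] contribute. *)
rewrite (@lmul_seq _ _ _ _ [:: i; i + 1]).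
- rewrite big_cons big_seq1 !laurentB !lmonomE.
  have -> : i - i = 0 by lia.
  have -> : i - (i + 1) = -1 by lia.
  by rewrite eqxx subr0 sub0r mulrN.
- by rewrite /= inE andbT; apply/eqP; lia.
move=> k; rewrite !inE negb_or => /andP[ki ki1].
rewrite laurentB !lmonomE !ifF ?subr0 ?mulr0 //.
  by apply/eqP => ?; case/eqP: ki1; lia.
by apply/eqP => ?; case/eqP: ki; lia.
Qed.

(** This is the coefficient of degree [m] in E(t) H(t) = 1. Terms with [k > m] vanish because [h]
    does at negative indices, so every bound [M] beyond [m] gives the same sum. *)
Lemma sum_E_h (r : rank) (m : int) (M : nat) : m < M%:Z ->
  \sum_(k < M) E r k * h r (m - k%:Z) = (m == 0)%:R.
Proof.
case: m => [m|m] ltmM; last first.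
  by apply: big1 => k _; rewrite h_neg ?mulr0 //; lia.
have {}ltmM : (m.+1 <= M)%N by lia.
have := fps_mulV (E0 r) m; rewrite /fps_mul eqz_nat => <-.
rewrite (big_ord_widen _ (fun k => E r k * fps_inv (E r) (m - k)%N) ltmM).
rewrite [RHS]big_mkcond; apply: eq_bigr => k _; case: ifPn => km.
  by rewrite -h_nat; congr (_ * h _ _); lia.
by rewrite h_neg ?mulr0 //; lia.
Qed.

(** The factorial in [U] undoes the one in [u], leaving the numbers a_k of the series u_j. *)
Lemma fact_u (r : rank) (k : nat) (j : int) :
  k`!%:R * u r j k = h r (k%:Z + j).
Proof.
rewrite /u mulr_natl scalerMnl -mulr_natr mulVf ?scale1r //.
by rewrite pnatr_eq0 -lt0n fact_gt0.
Qed.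

(** From the second column on the part is 0 and the entry is h_(i-j). The matrix is thus lower
    triangular, with diagonal h_n, 1, ..., 1, whatever its size. *)
Lemma det_h_single (r : rank) (n k : nat) :
  \det (\matrix_(i < k.+1, j < k.+1)
    h r ((part [:: n] j)%:Z - (j : nat)%:Z + (i : nat)%:Z)) = h r n.
Proof.
rewrite det_trig; last first.
  apply/is_trig_mxP => i [[|j] ltj] // ltij.
  by rewrite mxE /part /= nth_nil h_neg //; move: ltij => /=; lia.
rewrite big_ord_recl big1 ?mulr1.
  by rewrite mxE; congr h; rewrite /part /=; lia.
by move=> i _; rewrite mxE -(h0 r); congr h; rewrite /part /= nth_nil; lia.
Qed.

Lemma Delta_single (r : rank) (n : nat) : rank_pos r -> Delta r [:: n] = h r n.
Proof. by case: r => [[|k]|] // _; exact: det_h_single. Qed.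

Lemma Delta_nil (r : rank) : Delta r [::] = 1.
Proof.
rewrite /Delta det_trig.
  by apply: big1 => i _; rewrite mxE /part nth_nil -[RHS](h0 r); congr h; lia.
by apply/is_trig_mxP => i j ltij; rewrite mxE /part nth_nil h_neg //; lia.
Qed.

Lemma U_u (r : rank) (k : nat) (j : int) :
  U k (u r j) = \sum_(i < k.+1) E r i * h r ((k - i)%N%:Z + j).
Proof. by apply: eq_bigr => i _; rewrite fact_u. Qed.

Lemma U0u (r : rank) (j : int) : U 0 (u r j) = h r j.
Proof. by rewrite U_u big_ord1 add0r E0 mul1r. Qed.

Lemma U1u (r : rank) (j : int) : U 1 (u r j) = h r (j + 1) + E r 1 * h r j.
Proof. by rewrite U_u big_ord_recr big_ord1 add0r E0 mul1r [j + 1]addrC. Qed.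

Lemma det2 (R : comNzRingType) (M : 'M[R]_2) :
  \det M = M ord0 ord0 * M ord_max ord_max - M ord0 ord_max * M ord_max ord0.
Proof.
rewrite (expand_det_row _ ord0) !big_ord_recl big_ord0 addr0.
rewrite /cofactor !det_mx11 !mxE /= expr0 mul1r expr1 mulN1r mulrN.
by congr (_ * M _ _ - M _ _ * M _ _); exact: val_inj.
Qed.

Lemma bracket_row (r : rank) (n : nat) (i : int) :
  bracket r (wcons i (Phi (-1) [:: n])) =
  h r i * h r n - h r (i + 1) * h r (n%:Z - 1).
Proof.
rewrite /bracket [wtail _]/= det2 !mxE.
have -> : @windex 0 (wcons i (Phi (-1) [:: n])) (@ord_max 1) = n%:Z - 1.
  by rewrite -[LHS]/(-1 - 0%:Z + n%:Z) subr0 addrC.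
(* The second row contains [E r 1] times the first row, and this multiple cancels in the
   determinant. *)
transitivity (h r i * (h r (n%:Z - 1 + 1) + E r 1 * h r (n%:Z - 1))
    - h r (n%:Z - 1) * (h r (i + 1) + E r 1 * h r i)).
  apply: f_equal2; last apply: f_equal; apply: f_equal2;
    [exact: U0u | exact: U1u | exact: U0u | exact: U1u].
by rewrite subrK; ring.
Qed.

Lemma bracket_nil (r : rank) (i : int) : bracket r (wcons i (Phi (-1) [::])) = h r i.
Proof. by rewrite /bracket det_mx11 mxE; exact: U0u. Qed.

(** Partitions have no zero parts, so h_0 comes from the empty partition and its bracket has size 1
    instead of 2. The common formula survives because h_(-1) = 0. *)
Lemma h_as_Delta (r : rank) (n : int) : rank_pos r -> 0 <= n ->
  exists2 l, in_P r l & Delta r l = h r n /\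
    forall i, bracket r (wcons i (Phi (-1) l)) =
      h r i * h r n - h r (i + 1) * h r (n - 1).
Proof.
case: n => [[|n]|//] hr _.
  exists [::]; first by case: r {hr}.
  split=> [|i]; first exact: Delta_nil.
  by rewrite bracket_nil h0 mulr1 mulr0 subr0.
(* A partition with one part lies in P_r exactly because r is at least 1. *)
exists [:: n.+1]; first exact: hr.
by split=> [|i]; [exact: Delta_single | exact: bracket_row].
Qed.

(** Splits a coefficient of E(z) F(z) into two convolutions of [E] with shifts of [h], each given by
    [sum_E_h]. *)
Lemma sum_mulB_eq (R : comPzRingType) (M : nat) (p a b : nat -> R) (c d x y : R) :
    \sum_(k < M) p k * a k = x -> \sum_(k < M) p k * b k = y ->
  \sum_(k < M) p k * (a k * c - b k * d) = x * c - y * d.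
Proof. by move=> <- <-; rewrite !mulr_suml -sumrB; apply: eq_bigr => k _; ring. Qed.

Lemma lmul_E_h (r : rank) (n : int) (F : laurent r) :
  (forall i, F i = h r i * h r n - h r (i + 1) * h r (n - 1)) ->
  lmul (lfps (E r)) F = lmonom (h r n) 0 - lmonom (h r (n - 1)) (-1).
Proof.
move=> FE; apply: laurentP => i; rewrite laurentB !lmonomE.
(* Beyond [i + 1], both h_(i-k) and h_(i-k+1) vanish for all [k >= M]. *)
have [M ltiM] : exists M : nat, i + 1 < M%:Z by exists (absz (i + 1)%R).+1; lia.
rewrite (@lmul_lfps _ _ _ _ M); last first.
  move=> k leMk.
  by rewrite FE (@h_neg _ (i - k%:Z)) ?(@h_neg _ (i - k%:Z + 1)) ?mul0r ?subr0 //;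
    lia.
have ltiM' : i < M%:Z by lia.
(* The shift by one in the second convolution moves its only nonzero value to degree -1, which
   produces the term in 1/z. *)
transitivity ((i == 0)%:R * h r n - (i + 1 == 0)%:R * h r (n - 1)).
  rewrite -(sum_mulB_eq _ _ _ (fun k => h r (i - k%:Z)) (fun k => h r (i + 1 - k%:Z))
    _ _ _ _ (sum_E_h r _ _ ltiM') (sum_E_h r _ _ ltiM)).
  by apply: eq_bigr => k _; rewrite FE [_ + 1]addrAC.
by rewrite addr_eq0 !mulr_natl !mulrb.
Qed.

Theorem corollary6p6 (r : rank) (hr : rank_pos r)
    (Gamma G : {linear B r -> laurent r})
    (hGamma : is_Gamma Gamma) (hG : is_G Gamma G) (n : int) :
  Gamma (h r n) =
    lmul (lfps (fps_inv (E r))) (lmonom (h r n) 0 - lmonom (h r (n - 1)) (-1))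
  /\ G (h r n) = lmonom (h r n) 0 - lmonom (h r (n - 1)) (-1).
Proof.
suff [GE EG] : (forall i, Gamma (h r n) i =
      h r i * h r n - h r (i + 1) * h r (n - 1)) /\
    G (h r n) = lmul (lfps (E r)) (Gamma (h r n)).
  split; last by rewrite EG; exact: lmul_E_h.
  by apply: laurentP => i; rewrite GE lmul_lmonomB !lfps_inv_E.
(* For negative n, h_n is no [Delta], but h_n = h_(n-1) = 0 and linearity makes both sides zero. *)
have [n0|n0] := lerP 0 n; last first.
  have n1 : n - 1 < 0 by lia.
  rewrite (h_neg _ _ n0) (h_neg _ _ n1) !raddf0.
  split=> [i|]; first by rewrite !mulr0 subr0.
  by apply: laurentP => i; rewrite (@lmul_lfps _ _ _ _ 0) ?big_ord0.
have [l Pl [<- br]] := h_as_Delta r n hr n0.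
by split=> [i|]; [rewrite hGamma // br | exact: hG].
Qed.
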